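(* Let $r\ge 1$ and let $\mathfrak{b}$ be a Borel subalgebra of the complex special linear Lie algebra $\mathfrak{sl}_{r+1}$. For every integer $m\geq 1$, the number of abelian ideals of $\mathfrak{b}$ of dimension $m$ is equal to $\sum_{i=1}^{r}P_{i,r+1-i}(m)$. Besides these, there is exactly one further abelian ideal, the trivial (zero) one, of dimension $0$.
   Context: For integers $i,j\ge 1$ and $m\geq 1$, $P_{i,j}(m)$ denotes the number of partitions $m=\lambda_1+\lambda_2+\cdots+\lambda_i$ into exactly $i$ positive integer parts $\lambda_1\geq\lambda_2\geq\cdots\geq\lambda_i>0$ with $\lambda_1\leq j$. An abelian ideal of $\mathfrak{b}$ is an ideal $I$ of the Lie algebra $\mathfrak{b}$ with $[I,I]=0$; dimension is over $\mathbb{C}$. *)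

(* Defs.v *)
From HB Require Import structures.
From mathcomp Require Import all_boot all_order all_algebra.

Set Implicit Arguments.
Unset Strict Implicit.
Unset Printing Implicit Defensive.

Import GRing.Theory.
Local Open Scope ring_scope.

(* A tuple [l] over ['I_m.+1] stands for the sequence of the values of its
   entries; no part of a partition of [m] exceeds [m], so no partition is lost.
   As the sequence is nonincreasing, its head is its largest part. *)
Definition partition_parts (i m : nat) (l : i.-tuple 'I_m.+1) : seq nat :=
  map val l.

Definition is_bounded_partition (i j m : nat) (l : i.-tuple 'I_m.+1) : bool :=
  let s := partition_parts l in
  [&& sumn s == m, sorted geq s, all (fun x => 0 < x)%N s & (head 0 s <= j)%N].

Definition num_partitions (i j m : nat) : nat :=
  #|[pred l : i.-tuple 'I_m.+1 | is_bounded_partition j l]|.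

Section MatrixLieAlgebras.
Variables (K : fieldType) (n : nat).
Implicit Types (L I b U V : {vspace 'M[K]_n.+1}).

Definition lie_bracket (x y : 'M[K]_n.+1) : 'M[K]_n.+1 := x *m y - y *m x.

(* By bilinearity, the span of the brackets of basis elements is the span of
   all brackets [lie_bracket x y] with [x] in [U] and [y] in [V]. *)
Definition lie_bracketv U V : {vspace 'M[K]_n.+1} :=
  <<[seq lie_bracket x y | x <- vbasis U, y <- vbasis V]>>%VS.

Definition special_linear : {vspace 'M[K]_n.+1} :=
  lker (linfun (mxtrace : 'M[K]_n.+1 -> K^o)).

Definition lie_subalgebra L : Prop := (lie_bracketv L L <= L)%VS.

Definition lie_derived_series L (k : nat) : {vspace 'M[K]_n.+1} :=
  iter k (fun U => lie_bracketv U U) L.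

Definition lie_solvable L : Prop :=
  exists k : nat, lie_derived_series L k = 0%VS.

Definition solvable_subalgebra_sl L : Prop :=
  [/\ (L <= special_linear)%VS, lie_subalgebra L & lie_solvable L].

Definition borel_subalgebra_sl b : Prop :=
  solvable_subalgebra_sl b /\
  forall L, solvable_subalgebra_sl L -> (b <= L)%VS -> L = b.

Definition lie_ideal b I : Prop :=
  (I <= b)%VS /\ (lie_bracketv b I <= I)%VS.

Definition abelian_ideal b I : Prop :=
  lie_ideal b I /\ lie_bracketv I I = 0%VS.

End MatrixLieAlgebras.

(* Main.v *)
Require Import Defs.
From HB Require Import structures.
From mathcomp Require Import all_boot all_order all_algebra.
From mathcomp Require Import ring zify.
From mathcomp Require Import complex.
From mathcomp Require Import boolp classical_sets functions cardinality reals.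

(** Let [N = r.+1]. By Lie's theorem a solvable Lie algebra of matrices over an
    algebraically closed field of characteristic 0 can be conjugated into the
    lower triangular matrices. The traceless lower triangular matrices form a
    solvable Lie algebra [std_borel], so a maximal solvable subalgebra of
    [sl_N] is conjugate to it ([borel_conj_std]), and it is enough to count the
    abelian ideals of [std_borel].

    Such an ideal [I] is stable under bracketing with the diagonal matrix units.
    Two of these brackets isolate a single off-diagonal entry, so [I] contains
    the matrix unit [E_ij] as soon as one of its elements has a nonzero entry
    at (i, j) below the diagonal. Since [I] is abelian, its elements have
    constant, hence zero, diagonal. So [I] is spanned by the matrix units
    [E_ij] for (i, j) in a set [S] of positions below the diagonal. That [I] is
    an ideal says that [S] is closed under moving down and to the left; that
    [I] is abelian then says that every column index in [S] is smaller than
    every row index in [S] ([abelian_ideal_shape], [abelian_shape_ideal]).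

    A set closed under moving down and to the left is a Young diagram placed in
    the bottom left corner of the square, so it is described by the partition
    formed by the sizes of its columns. If there are [i] nonempty columns and
    the first one, the longest, has [j] positions, then the column indices in
    [S] are those below [i] and the row indices are those from [N - j] on. The
    condition on [S] becomes [i + j <= N]. The dimension of [I] is the sum of
    the parts ([young_abelian_shape], [abelian_shape_young]), and sorting by
    the number [i] of parts gives the stated sum ([hook_bounded_enum]).

    The proof of Lie's theorem is by induction on the derived length. Its main
    point is that the weight of the derived algebra on a common eigenvector
    vanishes on brackets with the whole algebra ([bracket_weight_eq0]). *)

Set Implicit Arguments.
Unset Strict Implicit.
Unset Printing Implicit Defensive.
Import GRing.Theory Num.Theory.
Local Open Scope ring_scope.

(** * Brackets of subspaces *)

Section Brackets.
Variables (K : fieldType) (n : nat).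
Implicit Types (U V W : {vspace 'M[K]_n.+1}) (x y : 'M[K]_n.+1).

Lemma lie_bracketC x y : lie_bracket x y = - lie_bracket y x.
Proof. by rewrite /lie_bracket opprB. Qed.

Lemma lie_bracket_suml I (r : seq I) (F : I -> 'M[K]_n.+1) (c : I -> K) z :
  lie_bracket (\sum_(i <- r) c i *: F i) z
  = \sum_(i <- r) c i *: lie_bracket (F i) z.
Proof.
rewrite /lie_bracket mulmx_suml mulmx_sumr -sumrB.
by apply: eq_bigr => i _; rewrite -scalemxAl -scalemxAr scalerBr.
Qed.

Lemma lie_bracket_sumr I (r : seq I) (F : I -> 'M[K]_n.+1) (c : I -> K) z :
  lie_bracket z (\sum_(i <- r) c i *: F i)
  = \sum_(i <- r) c i *: lie_bracket z (F i).
Proof.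
rewrite lie_bracketC lie_bracket_suml -sumrN.
by apply: eq_bigr => i _; rewrite -scalerN -lie_bracketC.
Qed.

Lemma lie_bracketv_subP U V W :
  reflect (forall x y, x \in U -> y \in V -> lie_bracket x y \in W)
          (lie_bracketv U V <= W)%VS.
Proof.
apply: (iffP idP) => [sW x y xU yV | sW]; last first.
  by apply/span_subvP => _ /allpairsP[[x y] [/= /vbasis_mem ? /vbasis_mem ? ->]];
    apply: sW.
rewrite (coord_vbasis xU) (coord_vbasis yV) lie_bracket_suml.
apply: memv_suml => i _; apply: memvZ; rewrite lie_bracket_sumr.
apply: memv_suml => j _; apply: memvZ; apply: (subvP sW); apply: memv_span.
by apply/allpairsP; exists ((vbasis U)`_i, (vbasis V)`_j);
  split => //=; apply: mem_nth; rewrite size_tuple.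
Qed.

Lemma mem_lie_bracketv U V x y :
  x \in U -> y \in V -> lie_bracket x y \in lie_bracketv U V.
Proof. by move: x y; apply/lie_bracketv_subP. Qed.

Lemma lie_bracketvS U U' V V' : (U <= U')%VS -> (V <= V')%VS ->
  (lie_bracketv U V <= lie_bracketv U' V')%VS.
Proof.
move=> /subvP sU /subvP sV; apply/lie_bracketv_subP => x y xU yV.
by apply: mem_lie_bracketv; [apply: sU | apply: sV].
Qed.

Lemma lie_derived_seriesS U k :
  lie_derived_series U k.+1
  = lie_derived_series (lie_bracketv U U) k.
Proof. exact: iterSr. Qed.

End Brackets.

(** * Lie's theorem *)

Section LieTheorem.

(** The weight is read off on one nonzero coordinate of [v], so it is linear in
    [x] on [L]; this is why finitely many eigenspaces, one for each vector of a
    basis of [L], already cut out the whole weight space. *)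
Lemma weight_space (K : fieldType) (N n : nat) (L : {vspace 'M[K]_N.+1})
    (rho : {linear 'M[K]_N.+1 -> 'M[K]_n}) (v : 'rV[K]_n) :
  v != 0 -> (forall x, x \in L -> stablemx v (rho x)) ->
  exists (lam : 'M[K]_N.+1 -> K) (W : 'M[K]_n), (v <= W)%MS /\
    forall m (w : 'M[K]_(m, n)), (w <= W)%MS <->
      forall x, x \in L -> w *m rho x = lam x *: w.
Proof.
move=> v0 stab; have [j vj] := rV0Pn _ v0.
pose lam x := (v 0 j)^-1 * (v *m rho x) 0 j.
have lamP x : x \in L -> v *m rho x = lam x *: v.
  by move=> /stab/sub_rVP[a ax]; rewrite /lam ax mxE mulrCA mulVf // mulr1.
pose W :=
  (\bigcap_(i < \dim L) eigenspace (rho (vbasis L)`_i) (lam (vbasis L)`_i))%MS.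
have bL (i : 'I_(\dim L)) : (vbasis L)`_i \in L.
  by apply: vbasis_mem; rewrite mem_nth // size_tuple.
have sW m (w : 'M[K]_(m, n)) : (w <= W)%MS <->
    forall x, x \in L -> w *m rho x = lam x *: w.
  split=> [/sub_bigcapmxP wW x xL|wW]; last first.
    by apply/sub_bigcapmxP => i _; apply/eigenspaceP/wW/bL.
  have -> : lam x = \sum_(i < \dim L) coord (vbasis L) i x * lam (vbasis L)`_i.
    rewrite {1}(coord_vbasis xL) /lam linear_sum mulmx_sumr summxE mulr_sumr.
    apply: eq_bigr => i _.
    by rewrite linearZ -scalemxAr mxE mulrCA.
  rewrite {1}(coord_vbasis xL) linear_sum mulmx_sumr scaler_suml.
  apply: eq_bigr => i _; rewrite linearZ -scalemxAr -scalerA.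
  by congr (_ *: _); apply/eigenspaceP/wW.
by exists lam, W; split => //; apply/sW.
Qed.

(** The next lemmas prove that the weight of a Lie ideal is invariant. The
    subspaces [krylov k], spanned by [v], [vY], ..., [vY^(k-1)], form a flag on
    which the matrices of the ideal act triangularly. *)
Section Krylov.
Variables (K : fieldType) (n : nat) (v : 'rV[K]_n) (Y : 'M[K]_n).

Definition krylov k : 'M[K]_n := (\sum_(i < k) <<v *m Y ^+ i>>)%MS.

Lemma krylov_next k : v *m Y ^+ k *m Y = v *m Y ^+ k.+1.
Proof. by rewrite exprSr -mulmxA. Qed.

Lemma krylovS k : krylov k.+1 = (krylov k + <<v *m Y ^+ k>>)%MS.
Proof. by rewrite /krylov big_ord_recr. Qed.

Lemma krylov_homo : {homo krylov : i j / (i <= j)%N >-> (i <= j)%MS}.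
Proof.
move=> i j; elim: j => [|j IH]; first by rewrite leqn0 => /eqP->.
rewrite leq_eqVlt ltnS => /predU1P[-> //|/IH sij].
by rewrite krylovS (submx_trans sij) ?addsmxSl.
Qed.

Lemma mem_krylov i k : (i < k)%N -> (v *m Y ^+ i <= krylov k)%MS.
Proof.
move=> ik; apply: submx_trans (krylov_homo ik).
by rewrite krylovS; apply: submx_trans (addsmxSr _ _); rewrite genmxE.
Qed.

Lemma krylov_sub m k (A : 'M[K]_(n, m)) (B : 'M[K]_m) :
  (forall i, (i < k)%N -> (v *m Y ^+ i *m A <= B)%MS) ->
  (krylov k *m A <= B)%MS.
Proof.
move=> sB; rewrite /krylov sumsmxMr_gen; apply/sumsmx_subP => i _.
by rewrite genmxE (eqmxMr _ (genmxE _)) sB.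
Qed.

Lemma krylov_mulY k : (krylov k *m Y <= krylov k.+1)%MS.
Proof. by apply: krylov_sub => i ik; rewrite krylov_next mem_krylov. Qed.

(** As long as [v *m Y ^+ k] escapes [krylov k] the rank grows by one, which
    can happen at most [n] times. *)
Lemma krylov_stop : exists k, (v *m Y ^+ k <= krylov k)%MS.
Proof.
have [/existsP[k vk]|/existsPn nov] :=
  boolP [exists k : 'I_n.+1, (v *m Y ^+ k <= krylov k)%MS]; first by exists k.
have rk k : (k <= n.+1)%N -> (k <= \rank (krylov k))%N.
  elim: k => // k IH lt_kn; apply: leq_ltn_trans (IH (ltnW lt_kn)) _.
  apply: rank_ltmx; rewrite ltmxE krylov_homo //=.
  by rewrite krylovS addsmx_sub submx_refl /= genmxE (nov (Ordinal lt_kn)).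
by have := leq_trans (rk _ (leqnn _)) (rank_leq_row _); rewrite ltnn.
Qed.

(** [P A a] is meant to say that [A] represents an element of an ideal, with
    weight [a] on [v]; [Y] represents an element of the algebra, so that
    bracketing with [Y] stays in the ideal. A relation is used because the
    representation need not be injective: the weight is a function of the
    element rather than of the matrix. *)
Variable P : 'M[K]_n -> K -> Prop.
Hypothesis P_act : forall A a, P A a -> v *m A = a *: v.
Hypothesis P_brk : forall A a, P A a -> exists b, P (A *m Y - Y *m A) b.

Lemma krylov_shift (k : nat) (A : 'M[K]_n) :
  v *m Y ^+ k.+1 *m A
  = v *m Y ^+ k *m A *m Y - v *m Y ^+ k *m (A *m Y - Y *m A).
Proof. by rewrite exprSr -mulmxE mulmxBr !mulmxA opprB addrC subrK. Qed.

(** Moving [A] across one factor [Y] costs a bracket, which is again in the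
    ideal and hence, by induction, triangular on the flag. The bracket is
    another matrix of the ideal, so the induction is on all [A] at once. *)
Lemma krylov_weight k A a : P A a ->
  (v *m Y ^+ k *m A - a *: (v *m Y ^+ k) <= krylov k)%MS.
Proof.
elim: k A a => [|k IH] A a PA.
  by rewrite expr0 mulmx1 (P_act PA) subrr sub0mx.
have [b PB] := P_brk PA.
have -> : v *m Y ^+ k.+1 *m A - a *: (v *m Y ^+ k.+1)
  = (v *m Y ^+ k *m A - a *: (v *m Y ^+ k)) *m Y
    - (v *m Y ^+ k *m (A *m Y - Y *m A) - b *: (v *m Y ^+ k))
    - b *: (v *m Y ^+ k).
  rewrite krylov_shift mulmxBl -scalemxAl krylov_next.
  move: (_ *m A *m Y) (_ *m (_ - _)) (_ *: _) (_ *: _) => p q s t.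
  by apply/rowP => j; rewrite !mxE; ring.
have sub_S : (krylov k <= krylov k.+1)%MS by apply: krylov_homo.
apply: addmx_sub; last by rewrite eqmx_opp scalemx_sub // mem_krylov.
apply: addmx_sub; last by rewrite eqmx_opp (submx_trans (IH _ _ PB)).
exact: submx_trans (submxMr _ (IH _ _ PA)) (krylov_mulY _).
Qed.

(** The subdiagonal coefficient: [A] meets each of the [k.+1] factors [Y] once,
    and each crossing contributes [- b]. On the flag, [A - a] thus behaves like
    the derivation [- b * d/dY]. *)
Lemma krylov_weight_bracket k A a b : P A a -> P (A *m Y - Y *m A) b ->
  ((v *m Y ^+ k.+1 *m A - a *: (v *m Y ^+ k.+1)
     + (k.+1%:R * b) *: (v *m Y ^+ k))%R <= krylov k)%MS.
Proof.
move=> PA PB; elim: k => [|k IH].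
  rewrite krylov_shift expr0 expr1 mulmx1 (P_act PA) (P_act PB) mul1r -scalemxAl.
  by rewrite addrAC addrNK subrr sub0mx.
have -> : v *m Y ^+ k.+2 *m A - a *: (v *m Y ^+ k.+2)
     + (k.+2%:R * b) *: (v *m Y ^+ k.+1)
  = (v *m Y ^+ k.+1 *m A - a *: (v *m Y ^+ k.+1)
     + (k.+1%:R * b) *: (v *m Y ^+ k)) *m Y
    - (v *m Y ^+ k.+1 *m (A *m Y - Y *m A) - b *: (v *m Y ^+ k.+1)).
  rewrite (krylov_shift k.+1) mulmxDl mulmxBl -!scalemxAl !krylov_next.
  move: (A *m Y - Y *m A) => B.
  move: (v *m Y ^+ k.+2) (v *m Y ^+ k.+1) => p q.
  move: (q *m A *m Y) (q *m B) => s t.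
  by apply/rowP => j; rewrite !mxE -[k.+2]addn1 natrD; ring.
apply: addmx_sub; last by rewrite eqmx_opp krylov_weight.
exact: submx_trans (submxMr _ IH) (krylov_mulY _).
Qed.

(** Let [d.+1] be the least exponent at which the flag stops growing. Then
    [A - a] maps [v *m Y ^+ d.+1], an element of [krylov d.+1], into [krylov d];
    but modulo [krylov d] its image is [- (d.+1 * b) *: v *m Y ^+ d], and
    [v *m Y ^+ d] is not in [krylov d] by minimality. In characteristic 0
    this forces [b = 0]. *)
Lemma bracket_weight_eq0 A a b : [pchar K] =i pred0 -> v != 0 ->
  P A a -> P (A *m Y - Y *m A) b -> b = 0.
Proof.
move=> charK0 v0 PA PB; apply/eqP/negPn/negP => b0.
have [d vd min_d] := ex_minnP krylov_stop.
case: d => [|d] in vd min_d *.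
  by move: vd; rewrite expr0 mulmx1 /krylov big_ord0 submx0 (negPf v0).
suff /min_d : (v *m Y ^+ d <= krylov d)%MS by rewrite ltnn.
have nz : d.+1%:R * b != 0 by rewrite mulf_neq0 // (pcharf0P K).1.
have shiftd u : (u <= krylov d.+1)%MS -> (u *m A - a *: u <= krylov d)%MS.
  move=> ud; rewrite -mul_mx_scalar -mulmxBr.
  apply: submx_trans (submxMr _ ud) _; apply: krylov_sub => i.
  rewrite ltnS => id; rewrite mulmxBr mul_mx_scalar.
  exact: submx_trans (krylov_weight _ PA) (krylov_homo id).
rewrite -(eqmx_scale _ nz) -(addrK (v *m Y ^+ d.+1 *m A - a *: (v *m Y ^+ d.+1))
  (_ *: _)) addmx_sub ?eqmx_opp ?shiftd // addrC.
exact: krylov_weight_bracket.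
Qed.
End Krylov.

(** Lie's theorem, for an arbitrary representation on row vectors so that it can
    be applied again to quotients. By induction the derived algebra [L'] has a
    weight space [W], and the weight vanishes on brackets of [L'] with [L], so
    [W] is stable under [L]. On [W] a bracket of two elements of [L] is a scalar
    of trace zero, hence zero: [L] acts on [W] by commuting matrices, which have
    a common eigenvector. *)
Lemma lie_common_eigenvector (C : numClosedFieldType) N k
    (L : {vspace 'M[C]_N.+1}) :
  lie_subalgebra L -> lie_derived_series L k = 0%VS ->
  forall n (rho : {linear 'M[C]_N.+1 -> 'M[C]_n}), (0 < n)%N ->
  {in L &, forall x y,
     rho (lie_bracket x y) = rho x *m rho y - rho y *m rho x} ->
  exists2 v : 'rV[C]_n, v != 0 & forall x, x \in L -> stablemx v (rho x).
Proof.
elim: k L => [|k IH] L subL derL n rho n_gt0 rhoM.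
  exists (delta_mx 0 (Ordinal n_gt0)) => [|x].
    by apply/rV0Pn; exists (Ordinal n_gt0); rewrite mxE !eqxx oner_eq0.
  rewrite [L]derL memv0 => /eqP->.
  by rewrite linear0 stablemx0.
set L' := lie_bracketv L L; have sL'L : (L' <= L)%VS := subL.
have L'L x : x \in L' -> x \in L by apply/subvP.
have brkL' x y : x \in L' -> y \in L -> lie_bracket x y \in L'.
  by move=> /L'L xL yL; apply: mem_lie_bracketv.
have [|||v v0 stab_v] := IH L' _ _ n rho n_gt0.
- exact: lie_bracketvS.
- by rewrite -lie_derived_seriesS.
- by move=> x y /L'L xL /L'L yL; apply: rhoM.
have [lam [W [vW sW]]] := weight_space v0 stab_v.
have char0 : [pchar C] =i pred0 by apply: pchar_num.
have lam_brk x y : x \in L' -> y \in L -> lam (lie_bracket x y) = 0.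
  move=> xL' yL.
  pose P A a := exists2 z, z \in L' & A = rho z /\ a = lam z.
  apply: (@bracket_weight_eq0 _ _ v (rho y) P _ _ (rho x) (lam x)) => //.
  - by move=> _ _ [z zL' [-> ->]]; apply/(sW _ v).1.
  - move=> _ _ [z zL' [-> _]]; exists (lam (lie_bracket z y)).
    by exists (lie_bracket z y); rewrite ?brkL' // rhoM // L'L.
  - by exists x.
  - by exists (lie_bracket x y); rewrite ?brkL' // rhoM // L'L.
have stabW y : y \in L -> stablemx W (rho y).
  move=> yL; apply/sW => x xL'; have WE := (sW _ W).1 (submx_refl W).
  have := congr1 (mulmx W) (rhoM _ _ (L'L _ xL') yL).
  rewrite WE ?brkL' // lam_brk // scale0r mulmxBr !mulmxA WE //.
  by rewrite -scalemxAl => /esym/eqP; rewrite subr_eq0 => /eqP<-.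
have rW : (0 < \rank W)%N.
  by rewrite lt0n mxrank_eq0; apply: contraNneq v0 => W0; rewrite -submx0 -W0.
have commW x y : x \in L -> y \in L ->
    comm_mx (restrictmx W (rho x)) (restrictmx W (rho y)).
  move=> xL yL; have zL' : lie_bracket x y \in L' by apply: mem_lie_bracketv.
  have stabB z : z \in L -> rho z \in [pred f | stablemx (row_base W) f].
    by move=> zL; rewrite inE stablemx_row_base stabW.
  have := congr1 (conjmx (row_base W)) (rhoM _ _ xL yL).
  rewrite [RHS]/conjmx mulmxBr mulmxBl -!/(conjmx _ _) !conjmxM ?stabB //.
  have -> : conjmx (row_base W) (rho (lie_bracket x y))
            = (lam (lie_bracket x y))%:M.
    apply: conjmx_eigenvalue (row_base_free W).
    by apply/eigenspaceP/(sW _ (row_base W)).1; rewrite ?eq_row_base.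
  move=> zE; have /eqP := congr1 mxtrace zE.
  rewrite mxtrace_scalar raddfB /= mxtrace_mulC subrr -mulr_natr mulf_eq0.
  rewrite (pcharf0P C).1 // (gtn_eqF rW) orbF => /eqP lam0.
  by apply/eqP; rewrite -subr_eq0 -zE lam0 raddf0.
have [|u u0 /allP stab_u] :=
  common_eigenvector (As := [seq restrictmx W (rho x) | x <- vbasis L]) rW.
  by move=> _ _ /mapP[x /vbasis_mem xL ->] /mapP[y /vbasis_mem yL ->];
     apply: commW.
exists (u *m row_base W).
  rewrite -[0](mul0mx _ (row_base W)).
  by rewrite (inj_eq (row_free_inj (row_base_free W))).
move=> x xL; rewrite (coord_vbasis xL) linear_sum mulmx_sumr.
apply: summx_sub => i _; rewrite linearZ -scalemxAr scalemx_sub //.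
have bL : (vbasis L)`_i \in vbasis L by rewrite mem_nth // size_tuple.
rewrite -stablemx_restrict ?stabW ?vbasis_mem //.
by apply: stab_u; apply: map_f.
Qed.

(** Lower triangular matrices are those preserving the standard flag of row
    vectors. The common eigenvector becomes the first basis vector, and the
    induction goes on with the representation on the quotient by its line,
    which is the lower right block. *)
Lemma lie_trigonalization (C : numClosedFieldType) N
    (L : {vspace 'M[C]_N.+1}) :
  lie_subalgebra L -> lie_solvable L ->
  forall n (rho : {linear 'M[C]_N.+1 -> 'M[C]_n}),
  {in L &, forall x y,
     rho (lie_bracket x y) = rho x *m rho y - rho y *m rho x} ->
  exists2 g : 'M[C]_n, g \in unitmx &
    forall x, x \in L -> is_trig_mx (g *m rho x *m invmx g).
Proof.
move=> subL [k derL]; elim=> [|n IH] rho rhoM.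
  by exists 1%:M => [|x _]; rewrite ?unitmx1 //; apply/is_trig_mxP => -[].
have [v v0 stab_v] := lie_common_eigenvector subL derL (ltn0Sn n) rhoM.
(* An invertible matrix whose first row is proportional to v. *)
pose h : 'M_(1 + n) := row_ebase v.
have h_unit : h \in unitmx by apply: row_ebase_unit.
pose c x : 'M_(1 + n) := conjmx h (rho x).
have cE x : c x = h *m rho x *m invmx h by rewrite /c conjumx.
have cM : {in L &, forall x y, c (lie_bracket x y) = c x *m c y - c y *m c x}.
  move=> x y xL yL; rewrite /c rhoM // -!conjmxM ?inE ?stablemx_unit //.
  by rewrite /conjmx mulmxBr mulmxBl.
have drP a (A B : 'M[C]_(1 + n)) :
    drsubmx (a *: A + B) = a *: drsubmx A + drsubmx B.
  by apply/matrixP => i j; rewrite !mxE.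
have ur0 x : x \in L -> ursubmx (c x) = 0.
  move=> xL.
  pose e : 'rV[C]_(1 + n) := row_mx 1%:M 0.
  have vE : v = col_ebase v *m (e *m h).
    rewrite -[LHS]mulmx_ebase rank_rV v0 -mulmxA; congr (_ *m (_ *m _)).
    apply/matrixP => i j; rewrite ord1 !mxE andbT.
    case: splitP => l ->; last by rewrite mxE eq_sym.
    by rewrite mxE ord1 !eqxx.
  have [a va] := sub_rVP (stab_v x xL).
  have ea : e *m c x = a *: e.
    rewrite cE !mulmxA -[RHS](mulmxK h_unit); congr (_ *m _).
    apply: (can_inj (mulKmx (col_ebase_unit v))).
    by rewrite mulmxA -vE va [in LHS]vE -scalemxAl -scalemxAr.
  move: ea; rewrite -[c x]submxK mul_row_block !mul1mx !mul0mx !addr0.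
  by rewrite block_mxKur scale_row_mx scaler0 => /eq_row_mx[].
pose rho' := (@drsubmx _ 1 n 1 n) \o c.
have rho'M : {in L &, forall x y,
     rho' (lie_bracket x y) = rho' x *m rho' y - rho' y *m rho' x}.
  move=> x y xL yL; rewrite /rho' /= cM // -scaleN1r addrC drP scaleN1r addrC.
  rewrite -[c x]submxK -[c y]submxK !mulmx_block !ur0 //.
  by rewrite !block_mxKdr !mulmx0 !add0r.
have lin' : linear rho'.
  move=> a x y; rewrite /rho' /c /conjmx /=.
  by rewrite linearP mulmxDr mulmxDl -scalemxAr -scalemxAl drP.
pose rhoL : {linear 'M[C]_N.+1 -> 'M[C]_n} :=
  HB.pack rho' (GRing.isLinear.Build _ _ _ _ rho' lin').
have [g g_unit g_trig] := IH rhoL rho'M.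
pose g1 : 'M[C]_(1 + n) := block_mx 1%:M 0 0 g.
have g1_unit : g1 \in unitmx by rewrite block_diag_mx_unit unitmx1.
exists (g1 *m h) => [|x xL]; first by rewrite unitmx_mul g1_unit.
rewrite -conjumx ?unitmx_mul ?g1_unit // conjuMumx // -/(c x).
have g1V : invmx g1 = block_mx 1%:M 0 0 (invmx g).
  by rewrite invmx_block_diag // invmx1.
rewrite conjumx // g1V /g1 -[c x]submxK ur0 // !(@mulmx_block _ 1 n 1 n 1 n).
rewrite !(mul1mx, mul0mx, mulmx0, mulmx1, addr0, add0r).
rewrite (@is_trig_block_mx _ 1 n 1 n) // eqxx g_trig // andbT.
by apply/is_trig_mxP => i j; rewrite !ord1.
Qed.
End LieTheorem.

(** * Conjugation of subspaces *)

Section Conjugation.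
Variables (K : fieldType) (n : nat).
Implicit Types (g x y : 'M[K]_n.+1) (U V b I : {vspace 'M[K]_n.+1}).

(** The direction is chosen so that [x \in conjv g U] means
    [g *m x *m invmx g \in U]. *)
Definition conjv g U : {vspace 'M[K]_n.+1} :=
  (linfun [the {linear 'M[K]_n.+1 -> 'M[K]_n.+1}
           of (mulmxr g \o mulmx (invmx g))%FUN] @: U)%VS.

Lemma mem_conjv g U x : g \in unitmx -> (x \in conjv g U) = (conjmx g x \in U).
Proof.
move=> g_unit; apply/memv_imgP/idP => [[y yU ->]|xU].
  by rewrite lfunE /= -conjVmx // conjmxVK.
by exists (conjmx g x); rewrite // lfunE /= -conjVmx // conjmxK.
Qed.

Lemma conjvK g : g \in unitmx -> cancel (conjv g) (conjv (invmx g)).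
Proof.
by move=> gu U; apply/vspaceP => x; rewrite !mem_conjv ?unitmx_inv // conjmxVK.
Qed.

Lemma conjvVK g : g \in unitmx -> cancel (conjv (invmx g)) (conjv g).
Proof. by move=> gu U; rewrite -{1}[g]invmxK conjvK // unitmx_inv. Qed.

Lemma dim_conjv g U : g \in unitmx -> \dim (conjv g U) = \dim U.
Proof.
move=> gu; apply: limg_dim_eq; apply/eqP; rewrite -subv0.
apply/subvP => x /memv_capP[_]; rewrite memv_ker lfunE /= => /eqP x0.
by rewrite memv0 -(conjmxVK x gu) conjVmx // x0 conjmx0.
Qed.

Lemma conjv0 g : g \in unitmx -> conjv g 0 = 0%VS.
Proof. by move=> gu; apply/eqP; rewrite -dimv_eq0 dim_conjv // dimv0. Qed.

Lemma conjmx_lie_bracket g x y : g \in unitmx ->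
  conjmx g (lie_bracket x y) = lie_bracket (conjmx g x) (conjmx g y).
Proof.
move=> gu; rewrite /lie_bracket -!conjmxM ?inE ?stablemx_unit //.
by rewrite /conjmx mulmxBr mulmxBl.
Qed.

Lemma conjv_derived g U k : g \in unitmx ->
  (lie_derived_series (conjv g U) k <= conjv g (lie_derived_series U k))%VS.
Proof.
move=> gu; elim: k => [|k IH] /=; first exact: subvv.
apply: subv_trans (lie_bracketvS IH IH) _.
apply/lie_bracketv_subP => x y; rewrite !mem_conjv // conjmx_lie_bracket //.
exact: mem_lie_bracketv.
Qed.

Lemma mem_special_linear x : (x \in special_linear K n) = (\tr x == 0).
Proof. by rewrite memv_ker lfunE. Qed.

Lemma conjv_solvable_sl g U : g \in unitmx ->
  solvable_subalgebra_sl U -> solvable_subalgebra_sl (conjv g U).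
Proof.
move=> gu [/subvP sU subU [k derU]]; split.
- apply/subvP => x; rewrite mem_conjv // => /sU; rewrite !mem_special_linear.
  by rewrite conjumx // mxtrace_mulC mulmxA mulVmx // mul1mx.
- apply/lie_bracketv_subP => x y; rewrite !mem_conjv // conjmx_lie_bracket //.
  by move: (conjmx g x) (conjmx g y); apply/lie_bracketv_subP.
exists k; apply/eqP; rewrite -subv0 -(conjv0 gu) -derU.
exact: conjv_derived.
Qed.

Lemma abelian_idealP b I : abelian_ideal b I <->
  [/\ (I <= b)%VS, (forall x y, x \in b -> y \in I -> lie_bracket x y \in I)
    & (forall x y, x \in I -> y \in I -> lie_bracket x y = 0)].
Proof.
split=> [[[sIb /lie_bracketv_subP idI] abI]|[sIb idI abI]].
  split=> // x y xI yI; apply/eqP; rewrite -memv0 -abI.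
  exact: mem_lie_bracketv.
split; first by split=> //; apply/lie_bracketv_subP.
apply/eqP; rewrite -subv0; apply/lie_bracketv_subP => x y xI yI.
by rewrite abI ?mem0v.
Qed.

Lemma conjv_abelian_ideal g b I : g \in unitmx ->
  abelian_ideal b I -> abelian_ideal (conjv g b) (conjv g I).
Proof.
move=> gu /abelian_idealP[/subvP sIb idI abI]; apply/abelian_idealP; split.
- by apply/subvP => x; rewrite !mem_conjv //; apply: sIb.
- by move=> x y; rewrite !mem_conjv // conjmx_lie_bracket //; apply: idI.
move=> x y; rewrite !mem_conjv // => xI yI.
by rewrite -[LHS](conjmxK _ gu) conjmx_lie_bracket // abI // conjmx0.
Qed.

End Conjugation.

(** * Subspaces spanned by matrix units, and the standard Borel subalgebra *)

Section Support.
Variables (K : fieldType) (n : nat).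
Implicit Types (S : rel 'I_n.+1) (x y : 'M[K]_n.+1).

Definition supp_space S : {vspace 'M[K]_n.+1} :=
  <<[seq delta_mx p.1 p.2
     | p <- enum [pred p : 'I_n.+1 * 'I_n.+1 | S p.1 p.2]]>>%VS.

Lemma mem_supp_space S x :
  reflect (forall i j, x i j != 0 -> S i j) (x \in supp_space S).
Proof.
apply: (iffP idP) => [| xS].
  rewrite /supp_space; set X := map _ _ => xX i j.
  have /coord_span-> : x \in <<in_tuple X>>%VS by [].
  apply: contraNT => nS; rewrite summxE big1 // => k _; rewrite mxE.
  have: X`_k \in X by rewrite mem_nth.
  case/mapP => p; rewrite mem_enum inE => Sp /= ->; rewrite mxE.
  case: andP => [[/eqP ip /eqP jp]|]; last by rewrite mulr0.
  by rewrite ip jp Sp in nS.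
rewrite (matrix_sum_delta x); apply: memv_suml => i _; apply: memv_suml => j _.
have [->|/xS Sij] := eqVneq (x i j) 0; first by rewrite scale0r mem0v.
by apply/memvZ/memv_span/mapP; exists (i, j); rewrite // mem_enum.
Qed.

Lemma dim_supp_space S :
  \dim (supp_space S) = #|[pred p : 'I_n.+1 * 'I_n.+1 | S p.1 p.2]|.
Proof.
rewrite /supp_space cardE.
move: (enum_uniq [pred p : 'I_n.+1 * 'I_n.+1 | S p.1 p.2]).
pose d (p : 'I_n.+1 * 'I_n.+1) : 'M[K]_n.+1 := delta_mx p.1 p.2.
move: (enum _) => E uniqE; rewrite -(size_map d) -/d.
apply/eqP; set X := map _ _.
have XE (l : 'I_(size X)) : X`_l = d (nth (ord0, ord0) E l).
  by rewrite (nth_map (ord0, ord0)) // -(size_map d).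
rewrite -[X]/(tval (in_tuple X)); apply/freeP => c c0 k.
pose p := nth (ord0, ord0) E k.
move/matrixP/(_ p.1 p.2): c0.
rewrite summxE (bigD1 k) //= big1 => [|l nlk]; rewrite XE /d !mxE.
  by rewrite !eqxx mulr1 addr0.
case: andP => [[/eqP e1 /eqP e2]|]; last by rewrite mulr0.
have : p == nth (ord0, ord0) E l.
  by rewrite [p]surjective_pairing [nth _ _ l]surjective_pairing e1 e2.
have sE (u : 'I_(size X)) : (u < size E)%N.
  by rewrite (leq_trans (ltn_ord u)) // size_map.
by rewrite nth_uniq // => /eqP/val_inj kl; rewrite kl eqxx in nlk.
Qed.

Lemma mulmx_supp_space S1 S2 S3 x y :
  (forall i l j, S1 i l -> S2 l j -> S3 i j) ->
  x \in supp_space S1 -> y \in supp_space S2 -> x *m y \in supp_space S3.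
Proof.
move=> S123 /mem_supp_space xS /mem_supp_space yS; apply/mem_supp_space => i j.
apply: contraNT => nS; rewrite mxE big1 // => l _; apply/eqP.
rewrite mulf_eq0; apply: contraNT nS; rewrite negb_or => /andP[/xS + /yS].
exact: S123.
Qed.

Lemma supp_space_delta S i j : (delta_mx i j \in supp_space S) = S i j.
Proof.
apply/mem_supp_space/idP => [/(_ i j)|Sij k l]; rewrite mxE.
  by rewrite !eqxx oner_eq0; apply.
by case: andP => [[/eqP-> /eqP->] //|]; rewrite eqxx.
Qed.

Definition std_borel : {vspace 'M[K]_n.+1} :=
  (supp_space (fun i j => j <= i)%N :&: special_linear K n)%VS.

Lemma mem_std_borel x : (x \in std_borel) = is_trig_mx x && (\tr x == 0).
Proof.
rewrite memv_cap mem_special_linear; congr (_ && _).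
apply/mem_supp_space/is_trig_mxP => xT i j.
  by move=> ij; apply/eqP/negPn/negP => /xT; rewrite leqNgt ij.
by apply: contraNT; rewrite -ltnNge => /xT->.
Qed.

Lemma tr_lie_bracket x y : \tr (lie_bracket x y) = 0.
Proof. by rewrite raddfB /= mxtrace_mulC subrr. Qed.

(** Bracketing two matrices supported at distance at least [k] below the
    diagonal doubles that distance. This gains nothing for [k = 0], where
    instead the diagonal entries of the two products cancel. *)
Lemma std_borel_derived k :
  (lie_derived_series std_borel k <= supp_space (fun i j => j + k <= i)%N)%VS.
Proof.
elim: k => [|k IH].
  apply/subvP => x /memv_capP[/mem_supp_space xS _].
  by apply/mem_supp_space => i j /xS; rewrite addn0.
apply: subv_trans (lie_bracketvS IH IH) _.
apply/lie_bracketv_subP => x y xS yS.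
case: k => [|k] in IH xS yS *; last first.
  by apply: memvB;
     [apply: mulmx_supp_space xS yS | apply: mulmx_supp_space yS xS]
       => i l j; lia.
have S0 u v : u \in supp_space (fun i j => j + 0 <= i)%N ->
    v \in supp_space (fun i j => j + 0 <= i)%N ->
    u *m v \in supp_space (fun i j => j <= i)%N.
  by apply: mulmx_supp_space => i l j; lia.
have xy0 := memvB (S0 _ _ xS yS) (S0 _ _ yS xS).
apply/mem_supp_space => i j nz; have ji := mem_supp_space _ _ xy0 _ _ nz.
rewrite addn1 ltn_neqAle ji andbT; apply: contraNN nz => /eqP/val_inj ->.
have diag u v : u \in supp_space (fun i j => j + 0 <= i)%N ->
    v \in supp_space (fun i j => j + 0 <= i)%N ->
    (u *m v) i i = u i i * v i i.
  move=> /mem_supp_space uS /mem_supp_space vS.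
  rewrite mxE (bigD1 i) //= big1 ?addr0 // => l nli; apply/eqP.
  rewrite mulf_eq0; apply: contraNT nli; rewrite negb_or => /andP[/uS + /vS].
  by rewrite !addn0 => *; rewrite -val_eqE /=; lia.
have -> : (x *m y - y *m x) i i = (x *m y) i i - (y *m x) i i by rewrite !mxE.
by rewrite !diag // mulrC subrr.
Qed.

Lemma std_borel_solvable : solvable_subalgebra_sl std_borel.
Proof.
split.
- exact: capvSr.
- apply/lie_bracketv_subP => x y /memv_capP[xS _] /memv_capP[yS _].
  apply/memv_capP; rewrite mem_special_linear tr_lie_bracket eqxx; split=> //.
  by apply: memvB;
     [apply: mulmx_supp_space xS yS | apply: mulmx_supp_space yS xS]
       => i l j; lia.
exists n.+1; apply/eqP; rewrite -subv0.
apply: subv_trans (std_borel_derived _) _.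
apply/subvP => x /mem_supp_space xS; rewrite memv0; apply/eqP/matrixP => i j.
by rewrite mxE; apply/eqP/negPn/negP => /xS; have := ltn_ord i; lia.
Qed.
End Support.

(** Lie's theorem puts [b] inside a conjugate of the standard Borel subalgebra,
    which is itself solvable, so that maximality gives equality. *)
Lemma borel_conj_std (C : numClosedFieldType) n (b : {vspace 'M[C]_n.+1}) :
  borel_subalgebra_sl b ->
  exists2 g : 'M[C]_n.+1, g \in unitmx & b = conjv g (std_borel C n).
Proof.
move=> [[sb subb solb] max_b].
have [g gu g_trig] :=
  @lie_trigonalization _ _ b subb solb _ idfun (fun _ _ _ _ => erefl).
exists g => //; apply/esym/max_b; first exact/conjv_solvable_sl/std_borel_solvable.
apply/subvP => x xb; rewrite mem_conjv // mem_std_borel conjumx // g_trig //=.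
move/subvP/(_ x xb): sb; rewrite mem_special_linear mxtrace_mulC mulmxA mulVmx //.
by rewrite mul1mx.
Qed.

(** * Abelian ideals of the standard Borel subalgebra *)

Section AbelianIdeals.
Variables (K : fieldType) (n : nat).
Implicit Types (S : rel 'I_n.+1) (x y : 'M[K]_n.+1) (I : {vspace 'M[K]_n.+1}).

(** The sets of positions that support an abelian ideal. The first condition
    says that [S] grows down and to the left, i.e. is an upper set of positive
    roots; the second, that every column index of [S] is smaller than every row
    index, combines strict triangularity with the vanishing of all products of
    two matrices supported in [S]. *)
Definition abelian_shape S :=
  (forall i j i' j' : 'I_n.+1,
     S i j -> (i <= i')%N -> (j' <= j)%N -> S i' j') /\
  (forall i j k l : 'I_n.+1, S i j -> S k l -> (j < k)%N).

Lemma lie_bracket_deltaE i j x k l :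
  lie_bracket (delta_mx i j) x k l = (k == i)%:R * x j l - (l == j)%:R * x k i.
Proof.
rewrite !mxE (bigD1 j) //= big1 => [|m nmj]; last first.
  by rewrite mxE (negPf nmj) andbF mul0r.
rewrite (bigD1 i) //= big1 => [|m nmi]; last first.
  by rewrite mxE (negPf nmi) mulr0.
by rewrite !mxE !eqxx andbT !addr0 [x k i * _]mulrC.
Qed.

Lemma abelian_shape_ideal S :
  abelian_shape S -> abelian_ideal (std_borel K n) (supp_space K S).
Proof.
move=> [upS sepS]; have low i j : S i j -> (j < i)%N.
  by move=> Sij; apply: (sepS _ _ _ _ Sij Sij).
apply/abelian_idealP; split.
- apply/subvP => x /mem_supp_space xS; rewrite mem_std_borel; apply/andP; split.
    apply/is_trig_mxP => i j ij; apply/eqP; apply: contraTT ij => /xS/low.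
    by rewrite -leqNgt; apply: ltnW.
  rewrite /mxtrace big1 // => i _; apply/eqP; apply/negPn/negP => /xS/low.
  by rewrite ltnn.
- move=> x y /memv_capP[xT _] yS.
  by apply: memvB;
     [apply: mulmx_supp_space xT yS | apply: mulmx_supp_space yS xT]
    => i l j Sa Sb; [apply: upS Sb _ _ | apply: upS Sa _ _].
move=> x y xS yS; apply/eqP; rewrite -memv0.
have <- : supp_space K (fun _ _ : 'I_n.+1 => false) = 0%VS.
  apply/eqP; rewrite -subv0; apply/subvP => z /mem_supp_space zS.
  rewrite memv0; apply/eqP/matrixP => i j.
  by rewrite mxE; apply/eqP/negPn/negP => /zS.
by apply: memvB; [apply: mulmx_supp_space xS yS | apply: mulmx_supp_space yS xS]
    => i l j Sa Sb; have := sepS _ _ _ _ Sa Sb; rewrite ltnn.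
Qed.

Hypothesis char0 : [pchar K] =i pred0.

(** Only traceless [y] belong to the subalgebra, but a triangular matrix can be
    made traceless by subtracting a scalar matrix, which commutes with [x]. *)
Lemma std_ideal_bracket I y x : abelian_ideal (std_borel K n) I ->
  is_trig_mx y -> x \in I -> lie_bracket y x \in I.
Proof.
move=> /abelian_idealP[_ idI _] y_trig xI.
pose a := \tr y / n.+1%:R.
have -> : lie_bracket y x = lie_bracket (y - a%:M) x.
  rewrite /lie_bracket mulmxBl mulmxBr scalar_mxC.
  by rewrite opprB addrA subrK.
apply: idI => //; rewrite mem_std_borel raddfB /= mxtrace_scalar.
rewrite -mulr_natr divfK ?((pcharf0P K).1 char0) // subrr eqxx andbT.
apply/is_trig_mxP => i j ij; rewrite !mxE (is_trig_mxP y_trig _ _ ij) sub0r.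
by rewrite -val_eqE /= ltn_eqF // oppr0.
Qed.

Lemma trig_delta (i j : 'I_n.+1) :
  (j <= i)%N -> is_trig_mx (delta_mx i j : 'M[K]_n.+1).
Proof.
move=> ji; apply/is_trig_mxP => k l kl; rewrite mxE.
case: andP => // -[/eqP ki /eqP lj].
by move: kl; rewrite ki lj ltnNge ji.
Qed.

(** The bracket with [E_ii] keeps only row [i] and column [i], with opposite
    signs and without the diagonal entry. Doing this for [i] and for [j] leaves
    the entries (i, j) and (j, i), and the latter is zero in a lower triangular
    matrix. *)
Lemma std_ideal_entry I x (i j : 'I_n.+1) : abelian_ideal (std_borel K n) I ->
  x \in I -> (j < i)%N -> x i j != 0 -> delta_mx i j \in I.
Proof.
move=> idI xI ji xij; have [/subvP sI _ _] := (abelian_idealP _ _).1 idI.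
have /andP[/is_trig_mxP x_trig _] : is_trig_mx x && (\tr x == 0).
  by rewrite -mem_std_borel sI.
have yI : lie_bracket (delta_mx j j) (lie_bracket (delta_mx i i) x) \in I.
  by do 2![apply: (std_ideal_bracket idI (trig_delta (leqnn _)))].
suff yE : lie_bracket (delta_mx j j) (lie_bracket (delta_mx i i) x)
       = - x i j *: delta_mx i j.
  by move: yI; rewrite yE rpredZeq oppr_eq0 (negPf xij).
have nij : i != j by rewrite -val_eqE /= gtn_eqF.
apply/matrixP => k l; rewrite !lie_bracket_deltaE !mxE.
rewrite (x_trig j i) // mulr0 subr0 [j == i]eq_sym (negPf nij) !mul0r !subr0.
by rewrite -mulnb natrM; ring.
Qed.

(** The lemma [std_ideal_entry] makes the strictly lower part of [I] a span of
    matrix units, so the point is that elements of [I] have zero diagonal. If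
    [x] in [I] had different diagonal entries at [i] and [j], then [E_ij] would
    be in [I] and would not commute with [x]; so the diagonal is constant, and
    zero because the trace is. The shape conditions then follow by bracketing
    matrix units. *)
Lemma abelian_ideal_shape I : abelian_ideal (std_borel K n) I ->
  exists2 S, abelian_shape S & I = supp_space K S.
Proof.
move=> idI; have [/subvP sI _ abI] := (abelian_idealP _ _).1 idI.
have trigI x : x \in I -> is_trig_mx x && (\tr x == 0).
  by move=> /sI; rewrite mem_std_borel.
have eq_diag x i j : x \in I -> x i i = x j j.
  wlog ji : i j / (j < i)%N => [wl xI|xI].
    by case: (ltngtP i j) => [/wl->|/wl->|/val_inj->].
  apply/eqP; rewrite -subr_eq0; apply/negPn/negP => xij.
  have yI : lie_bracket (delta_mx i j) x \in I.
    by apply: std_ideal_bracket => //; apply/trig_delta/ltnW.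
  have yE : lie_bracket (delta_mx i j) x i j = x j j - x i i.
    by rewrite lie_bracket_deltaE !eqxx !mul1r.
  have dI : delta_mx i j \in I.
    by apply: (std_ideal_entry idI yI ji); rewrite yE -opprB oppr_eq0.
  move: yE; rewrite abI // mxE => /esym/eqP.
  by rewrite -opprB oppr_eq0 (negPf xij).
have diag0 x i : x \in I -> x i i = 0.
  move=> xI; have /andP[_] := trigI x xI; rewrite /mxtrace.
  rewrite (eq_bigr (fun=> x i i)) => [|j _]; last exact: eq_diag.
  by rewrite sumr_const card_ord -mulr_natr mulf_eq0 (pcharf0P K).1 // orbF => /eqP.
have low (i j : 'I_n.+1) : delta_mx i j \in I -> (j < i)%N.
  move=> dI; have /andP[/is_trig_mxP d_trig _] := trigI _ dI.
  have d1 : (delta_mx i j : 'M[K]_n.+1) i j = 1 by rewrite mxE !eqxx.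
  case: (ltngtP j i) => // [/d_trig|/val_inj ji].
    by rewrite d1 => /eqP; rewrite oner_eq0.
  by have := diag0 _ i dI; rewrite -{3}ji d1 => /eqP; rewrite oner_eq0.
have entI x i j : x \in I -> x i j != 0 -> delta_mx i j \in I.
  move=> xI xij; apply: (std_ideal_entry idI xI) (xij).
  have /andP[/is_trig_mxP x_trig _] := trigI _ xI.
  apply/negPn/negP; rewrite -leqNgt leq_eqVlt => /orP[/eqP/val_inj ij|/x_trig x0].
    by rewrite ij diag0 ?eqxx in xij.
  by rewrite x0 eqxx in xij.
have upr (i i' j : 'I_n.+1) :
    delta_mx i j \in I -> (i <= i')%N -> delta_mx i' j \in I.
  move=> dI; rewrite leq_eqVlt => /orP[/eqP/val_inj <- //|ii'].
  apply: (entI (lie_bracket (delta_mx i' i) (delta_mx i j))).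
    by apply: std_ideal_bracket => //; apply/trig_delta/ltnW.
  rewrite lie_bracket_deltaE !mxE !eqxx mul1r -!val_eqE /=.
  by rewrite (ltn_eqF (low _ _ dI)) mul0r subr0 oner_eq0.
have upc (i j j' : 'I_n.+1) :
    delta_mx i j \in I -> (j' <= j)%N -> delta_mx i j' \in I.
  move=> dI; rewrite leq_eqVlt => /orP[/eqP/val_inj -> //|j'j].
  apply: (entI (lie_bracket (delta_mx j j') (delta_mx i j))).
    by apply: std_ideal_bracket => //; apply/trig_delta/ltnW.
  rewrite lie_bracket_deltaE !mxE !eqxx mul1r -!val_eqE /=.
  by rewrite (gtn_eqF (low _ _ dI)) mul0r sub0r oppr_eq0 oner_eq0.
exists (fun i j => delta_mx i j \in I).
  split=> [i j i' j' dI ii' j'j|i j k l dij dkl].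
    exact: upc (upr _ _ _ dI ii') j'j.
  (* Otherwise E_jl lies in I, and [E_ij, E_jl] = E_il is not zero. *)
  rewrite ltnNge; apply/negP => kj; have djl := upr _ _ _ dkl kj.
  have := abI _ _ dij djl; move/matrixP/(_ i l).
  rewrite lie_bracket_deltaE !mxE !eqxx mul1r -[l == j]val_eqE /=.
  rewrite (ltn_eqF (low _ _ djl)).
  by rewrite mul0r subr0 => /eqP; rewrite oner_eq0.
apply/vspaceP => x; apply/idP/mem_supp_space => [xI i j|xS]; first exact: entI.
rewrite (matrix_sum_delta x); apply: memv_suml => i _; apply: memv_suml => j _.
have [->|/xS dI] := eqVneq (x i j) 0; first by rewrite scale0r mem0v.
exact: memvZ.
Qed.

End AbelianIdeals.

(** * Abelian shapes as partitions *)

Section Diagrams.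
Local Open Scope nat_scope.

Lemma nth_sorted_geq s i j : sorted geq s -> i <= j -> nth 0 s j <= nth 0 s i.
Proof.
move=> s_sorted ij; have [js|sj] := ltnP j (size s); last by rewrite nth_default.
have geq_trans : transitive geq by move=> y x z xy yz; apply: leq_trans yz xy.
by apply: (sorted_leq_nth geq_trans leqnn 0 s_sorted); rewrite ?inE ?(leq_ltn_trans ij).
Qed.

Lemma nth_filter_pos s j :
  sorted geq s -> nth 0 (filter (leq 1) s) j = nth 0 s j.
Proof.
elim: s j => [|x s IH] j //= xs; have [x0|] := posnP x; last first.
  by case: j => //= j _; apply: IH (path_sorted xs).
rewrite -[in RHS]/(nth 0 (x :: s) j) IH ?(path_sorted xs) //.
have all0 k : nth 0 (x :: s) k = 0.
  by have := nth_sorted_geq (s := x :: s) xs (leq0n k); rewrite /= x0; lia.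
by rewrite -[LHS]/(nth 0 (x :: s) j.+1) !all0.
Qed.

(** The default value 0 marks the end of a sequence of positive integers, so
    such a sequence is determined by its entries, its length included. *)
Lemma eq_from_nth_pos s t : all (leq 1) s -> all (leq 1) t ->
  (forall j, nth 0 s j = nth 0 t j) -> s = t.
Proof.
move=> s_pos t_pos eq_st.
have size_le u w : all (leq 1) u -> (forall j, nth 0 u j = nth 0 w j) ->
    size u <= size w.
  move=> u_pos eq_uw; rewrite leqNgt; apply/negP => lt_wu.
  by have := all_nthP 0 u_pos _ lt_wu; rewrite eq_uw nth_default.
apply: (@eq_from_nth _ 0) => //; apply/eqP.
by rewrite eqn_leq !size_le.
Qed.

Lemma sum_geq_ord N c : \sum_(i < N) (c <= i) = N - c.
Proof.
elim: N => [|N IH]; first by rewrite big_ord0.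
by rewrite big_ord_recr /= IH; lia.
Qed.

Lemma sumn_nth s N : size s <= N -> sumn s = \sum_(j < N) nth 0 s j.
Proof.
elim: s N => [|x s IH] [|N] //= sN; first by rewrite big_ord0.
  by rewrite big1 // => j _; rewrite nth_nil.
by rewrite big_ord_recl /= (IH N).
Qed.

Variable n : nat.
Implicit Types (s : seq nat) (S : rel 'I_n.+1).

(** The Young diagram of [s] pushed into the bottom left corner: column [j]
    holds the [nth 0 s j] lowest positions. *)
Definition young_shape s : rel 'I_n.+1 := fun i j => n.+1 <= i + nth 0 s j.

(** The last condition bounds the largest hook of the Young diagram by [n]. It
    says that [s] has [i] parts, all at most [n.+1 - i], for some [i]. *)
Definition is_hook_bounded m s :=
  [&& s != [::], sumn s == m, sorted geq s, all (leq 1) s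
    & head 0 s + size s <= n.+1].

Lemma sum_column a : a <= n.+1 -> \sum_(i < n.+1) (n.+1 <= i + a) = a.
Proof.
move=> aN; rewrite -[RHS](subKn aN) -sum_geq_ord.
by apply: eq_bigr => i _; congr nat_of_bool; lia.
Qed.

Lemma card_shape S :
  #|[pred p : 'I_n.+1 * 'I_n.+1 | S p.1 p.2]| = \sum_j \sum_i S i j.
Proof. by rewrite -sum1_card big_mkcond exchange_big pair_big. Qed.

Lemma card_young_shape s : size s <= n.+1 -> (forall j, nth 0 s j <= n.+1) ->
  \sum_j \sum_i young_shape s i j = sumn s.
Proof.
move=> sN ls; rewrite (sumn_nth sN).
by apply: eq_bigr => j _; rewrite sum_column.
Qed.

Lemma hook_bounded_le m s : is_hook_bounded m s ->
  size s <= n.+1 /\ forall j, nth 0 s j <= n.+1.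
Proof.
case/and5P=> _ _ s_sorted _ hs; split; first lia.
by move=> j; have := nth_sorted_geq s_sorted (leq0n j); rewrite nth0; lia.
Qed.

Lemma young_shape_inj m s t : is_hook_bounded m s -> is_hook_bounded m t ->
  young_shape s =2 young_shape t -> s = t.
Proof.
move=> hs ht eqS; have [ss ls] := hook_bounded_le hs.
have [st lt] := hook_bounded_le ht.
case/and5P: hs => _ _ _ s_pos _; case/and5P: ht => _ _ _ t_pos _.
apply: eq_from_nth_pos => // j; have [jn|nj] := ltnP j n.+1; last first.
  by rewrite !nth_default // (leq_trans _ nj).
rewrite -(sum_column (ls j)) -(sum_column (lt j)); apply: eq_bigr => i _.
by have := eqS i (Ordinal jn); rewrite /young_shape /= => ->.
Qed.

(** The columns of the diagram are numbered below [size s], and its rows from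
    [n.+1 - head 0 s] on; the hook condition separates the two ranges. *)
Lemma young_abelian_shape m s :
  is_hook_bounded m s -> abelian_shape (young_shape s).
Proof.
case/and5P=> _ _ s_sorted _ hs; rewrite /young_shape; split.
  move=> i j i' j' Sij ii' j'j; have := nth_sorted_geq s_sorted j'j; lia.
move=> i j k l Sij Skl; have := nth_sorted_geq s_sorted (leq0n l); rewrite nth0 => nl.
have [js|sj] := ltnP j (size s); first lia.
by move: Sij; rewrite nth_default //; have := ltn_ord i; lia.
Qed.

(** The parts are the numbers of positions in the columns of [S], without the
    empty columns. The hook condition comes from comparing the last nonempty
    column with the top row of the first column. *)
Lemma abelian_shape_young m S :
  0 < m -> abelian_shape S -> \sum_j \sum_i S i j = m ->
  exists2 s, is_hook_bounded m s & S =2 young_shape s.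
Proof.
move=> m_gt0 [upS sepS] card_S.
pose col j := \sum_i S i j.
have colS i j : S i j = (n.+1 <= i + col j).
  have [c cS] : exists c, forall k : 'I_n.+1, S k j = (c <= k).
    pose P c := [forall k : 'I_n.+1, (c <= k) ==> S k j].
    have exP : exists c, P c.
      by exists n.+1; apply/forallP => k; rewrite leqNgt ltn_ord.
    exists (ex_minn exP) => k.
    case: ex_minnP => c /forallP/(_ k)/implyP Pc min_c.
    apply/idP/idP => // Skj; apply: min_c.
    by apply/forallP => k'; apply/implyP => kk'; apply: upS Skj kk' _.
  rewrite cS /col.
  rewrite (eq_bigr (fun k : 'I_n.+1 => nat_of_bool (c <= k))) => [|k _].
    by rewrite sum_geq_ord; have := ltn_ord i; lia.
  by rewrite cS.
have col_anti (j j' : 'I_n.+1) : j <= j' -> col j' <= col j.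
  move=> jj'; apply: leq_sum => i _; have [Sij'|//] := boolP (S i j').
  by rewrite (upS _ _ _ _ Sij').
pose u := mkseq (fun j => col (inord j)) n.+1.
have nth_u (j : 'I_n.+1) : nth 0 u j = col j by rewrite nth_mkseq // inord_val.
have u_sorted : sorted geq u.
  apply/(sortedP 0) => j; rewrite size_mkseq => jn.
  by rewrite /u !nth_mkseq ?(ltnW jn) //= col_anti // !inordK // ltnW.
pose s := filter (leq 1) u.
have eqS : S =2 young_shape s.
  by move=> i j; rewrite colS /young_shape nth_filter_pos // nth_u.
have s_size : size s <= n.+1.
  by rewrite size_filter (leq_trans (count_size _ _)) ?size_mkseq.
have s_le j : nth 0 s j <= n.+1.
  rewrite nth_filter_pos //; have [jn|nj] := ltnP j n.+1; last first.
    by rewrite nth_default ?size_mkseq.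
  have -> : n.+1 = \sum_(i < n.+1) 1 by rewrite sum1_card card_ord.
  by rewrite nth_mkseq //; apply: leq_sum => i _; case: (S _ _).
have sum_s : sumn s = m.
  rewrite -card_S -card_young_shape //.
  by apply: eq_bigr => j _; apply: eq_bigr => i _; rewrite eqS.
have s_pos : all (leq 1) s by apply: filter_all.
have s_nil : s != [::] by apply: contraTneq m_gt0 => s0; rewrite -sum_s s0.
exists s => //; apply/and5P; split=> //; first exact/eqP.
  by apply: sorted_filter u_sorted => y x z xy yz; apply: leq_trans yz xy.
have [s_gt0 h_gt0] : 0 < size s /\ 0 < head 0 s.
  by case: (s) s_nil s_pos => //= x t _ /andP[].
have l_lt : (size s).-1 < n.+1 by lia.
have h_lt : n.+1 - head 0 s < n.+1 by lia.
have S1 : S ord_max (Ordinal l_lt).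
  rewrite eqS /young_shape /=; have := all_nthP 0 s_pos (size s).-1; lia.
have S2 : S (Ordinal h_lt) ord0.
  by rewrite eqS /young_shape /= nth0; have := s_le 0; rewrite nth0; lia.
by have := sepS _ _ _ _ S1 S2; rewrite /=; lia.
Qed.

(** Sorting these partitions of [m] by their number [i] of parts, from 1 to
    [n], bounds the largest part by [n.+1 - i]. *)
Lemma hook_bounded_enum m :
  exists f :
    'I_(\sum_(1 <= i < n.+1) num_partitions i (n.+1 - i) m) -> seq nat,
    injective f /\ forall s, is_hook_bounded m s <-> exists k, f k = s.
Proof.
pose T := {i : 'I_n &
  {l : i.+1.-tuple 'I_m.+1 | is_bounded_partition (n.+1 - i.+1) l}}.
have cardT :
    #|{: T}| = \sum_(1 <= i < n.+1) num_partitions i (n.+1 - i) m.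
  rewrite card_tagged sumnE big_map big_enum big_add1 big_mkord /=.
  by apply: eq_bigr => i _; rewrite card_sig.
pose g (t : T) : seq nat := partition_parts (val (tagged t)).
have g_inj : injective g.
  move=> [i [l Pl]] [i' [l' Pl']]; rewrite /g /= => eqg.
  have := congr1 size eqg; rewrite !size_map !size_tuple => -[/val_inj ei].
  case: i' / ei l' Pl' eqg => l' Pl' eqg.
  have el : l = l' by apply/val_inj/(inj_map val_inj).
  by case: l' / el Pl' {eqg} => Pl'; congr existT; apply: val_inj.
have gP s : is_hook_bounded m s <-> exists t, g t = s.
  split=> [/and5P[s_nil /eqP sum_s s_sorted s_pos hs]
          |[[i [l /= Pl]] <-]]; last first.
    case/and4P: (Pl) => sum_l l_sorted l_pos hl; apply/and5P; split=> //.
    - by rewrite -size_eq0 size_map size_tuple.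
    by rewrite size_map size_tuple /g /=; have := ltn_ord i; lia.
  have s_gt0 : 0 < size s by case: (s) s_nil.
  have h_gt0 : 0 < head 0 s by case: (s) s_nil s_pos => //= x t _ /andP[].
  have i_lt : (size s).-1 < n by lia.
  have sz : size [seq inord x : 'I_m.+1 | x <- s] == (Ordinal i_lt).+1.
    by rewrite size_map /= prednK.
  have parts_s : [seq val y | y <- [seq inord x : 'I_m.+1 | x <- s]] = s.
    rewrite -map_comp -[RHS]map_id; apply/eq_in_map => x xs /=.
    rewrite inordK // ltnS -sum_s.
    by elim: (s) xs => //= y t IH; rewrite inE => /orP[/eqP->|/IH]; lia.
  have Ps : is_bounded_partition (n.+1 - (Ordinal i_lt).+1) (Tuple sz).
    rewrite /is_bounded_partition /partition_parts /= parts_s.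
    by rewrite sum_s eqxx s_sorted s_pos /=; lia.
  by exists (existT _ (Ordinal i_lt) (exist _ (Tuple sz) Ps)).
rewrite -cardT; exists (g \o enum_val); split.
  exact: inj_comp g_inj enum_val_inj.
move=> s; rewrite gP; split=> [[t <-]|[k <-]]; last by exists (enum_val k).
by exists (enum_rank t); rewrite /= enum_rankK.
Qed.

End Diagrams.

Local Open Scope classical_set_scope.
Local Open Scope card_scope.

Theorem proposition3p1 (R : realType) (r : nat) (hr : (1 <= r)%N)
    (b : {vspace 'M[R[i]]_r.+1}) (hb : borel_subalgebra_sl b) :
  (forall m : nat, (1 <= m)%N ->
     [set I : {vspace 'M[R[i]]_r.+1} | abelian_ideal b I /\ \dim I = m] #=
     `I_(\sum_(1 <= i < r.+1) num_partitions i (r.+1 - i) m)%N) /\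
  [set I : {vspace 'M[R[i]]_r.+1} | abelian_ideal b I /\ \dim I = 0%N] =
    [set 0%VS].
Proof.
split=> [m m_gt0|]; last first.
  apply/seteqP; split=> [I [_ /eqP]|I ->] /=; first by rewrite dimv_eq0 => /eqP.
  rewrite dimv0; split=> //; apply/abelian_idealP; split; first exact: sub0v.
    move=> x y _; rewrite !memv0 => /eqP->.
    by rewrite /lie_bracket mulmx0 mul0mx subrr.
  move=> x y _; rewrite memv0 => /eqP->.
  by rewrite /lie_bracket mulmx0 mul0mx subrr.
have [g gu ->] := borel_conj_std hb.
have [f [f_inj fP]] := hook_bounded_enum r m.
have hook k : is_hook_bounded r m (f k) by apply/fP; exists k.
pose F k := conjv g (supp_space R[i] (@young_shape r (f k))).
have -> :
    [set I | abelian_ideal (conjv g (std_borel R[i] r)) I /\ \dim I = m]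
    = F @` [set: 'I__].
  apply/seteqP; split=> [I [idI dimI]|_ [k _ <-]] /=; last first.
    split.
      exact/conjv_abelian_ideal/abelian_shape_ideal/young_abelian_shape.
    have [ss ls] := hook_bounded_le (hook k).
    rewrite dim_conjv // dim_supp_space card_shape card_young_shape //.
    by case/and5P: (hook k) => _ /eqP.
  have gVu : invmx g \in unitmx by rewrite unitmx_inv.
  have := conjv_abelian_ideal gVu idI; rewrite conjvK // => idJ.
  have [S shS JE] := abelian_ideal_shape (pchar_num _) idJ.
  have := dim_conjv I gVu; rewrite dimI JE dim_supp_space card_shape => cardJ.
  have [s hs eqS] := abelian_shape_young m_gt0 shS cardJ.
  have [k fk] := (fP s).1 hs; exists k => //.
  rewrite /F fk -[RHS](conjvVK gu) JE; congr (conjv g _).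
  by apply/vspaceP => x; apply/mem_supp_space/mem_supp_space => xS i j /xS;
     rewrite eqS.
rewrite (card_eql (inj_card_eq _)); first by rewrite card_eq_sym card_II.
move=> k k' _ _ /(can_inj (conjvK gu)) eqF.
apply/f_inj/(young_shape_inj (hook k) (hook k')) => i j.
by rewrite -!(supp_space_delta R[i]) eqF.
Qed.
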